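(* There is an algorithm (oracle) $\mathcal R$ which, given the data of a linear or quasi-linear Fisher market (as in the context) together with $\mu\in\mathbb R^m$ and $r\in\mathbb R$, returns an output $\mathcal R(\mu,r)$ using at most $\mathcal O((m+n)^2)$ arithmetic operations, and such that for every such market there exists a constant $\Delta^*>0$ with $$\mathcal R(\mu,r)=\mu^*\quad\text{whenever } \mu\in\mathbb B(\mu^*,r)\ \text{ and }\ 0<r<\Delta^*/4,$$ where $\mu^*$ is the minimizer of $F$ over $\mathbb R^m$.
   Context: Market. There are $m\ge1$ goods and $n\ge1$ buyers; $[m]=\{1,\dots,m\}$. Buyer $i$ has budget $B_i>0$, and the utility matrix $v=(v_{ij})\in\mathbb R^{n\times m}$ has nonnegative entries and no zero row or zero column. A parameter $\alpha\in\{1,+\infty\}$ selects quasi-linear ($\alpha=1$) or linear ($\alpha=+\infty$) utilities. The market data are $(m,n,v,B,\alpha)$; the oracle is not given $\mu^*$ or $\Delta^*$. Conventions: $v_{i0}=1$ for all $i$; $\mu_0=\log\alpha\in\{0,+\infty\}$; $\log0=-\infty$. Objective. For $\mu\in\mathbb R^m$, $$F(\mu)=\sum_{j\in[m]}\exp(\mu_j)+\sum_{i\in[n]}B_i\max_{j\in\{0\}\cup[m]}\{\log(v_{ij})-\mu_j\},$$ which has a unique minimizer $\mu^*\in\mathbb R^m$; the competitive equilibrium prices of the market are $p^*_j=\exp(\mu^*_j)$. $\mathbb B(\mu^*,r)$ is the closed Euclidean ball of center $\mu^*$ and radius $r$. Elementary arithmetic operations on reals include comparisons and evaluations of $\exp$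 and $\log$; the constant in $\mathcal O(\cdot)$ is absolute. *)

(* Defs.v *)
From mathcomp Require Import all_boot all_order all_algebra.
From mathcomp Require Import all_classical all_reals all_analysis.

Set Implicit Arguments.
Unset Strict Implicit.
Unset Printing Implicit Defensive.

Import Order.TTheory GRing.Theory Num.Theory.

Local Open Scope ring_scope.

(* alpha = 1 is the quasi-linear market and alpha = +oo the linear one. *)
Record fisher_market (R : realType) (m n : nat) := FisherMarket {
  utility : 'M[R]_(n, m);
  budget : 'rV[R]_n;
  alpha : \bar R;
  utility_ge0 : forall i j, 0 <= utility i j;
  utility_row_neq0 : forall i, exists j, utility i j != 0;
  utility_col_neq0 : forall j, exists i, utility i j != 0;
  budget_gt0 : forall i, 0 < budget 0 i;
  alpha_1_or_y : alpha = 1%E \/ alpha = +oo%E }.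

Section objective.
Context {R : realType} {m n : nat} (M : fisher_market R m n).

(* The index set {0} U [m] is option 'I_m, with None for the index 0. *)
Definition ext_utility (i : 'I_n) (j : option 'I_m) : R :=
  if j is Some j' then utility M i j' else 1.

Definition ext_logprice (mu : 'rV[R]_m) (j : option 'I_m) : \bar R :=
  if j is Some j' then (mu 0 j')%:E else lne (alpha M).

(* lne is the extended logarithm: lne 0 = -oo and lne +oo = +oo.  Since no row
   of the utility matrix vanishes, the value of F is always finite. *)
Definition F (mu : 'rV[R]_m) : \bar R :=
  ((\sum_(j < m) expR (mu 0 j))%:E +
   \sum_(i < n) (budget M 0 i)%:E *
     \big[maxe/-oo]_(j : option 'I_m)
        (lne (ext_utility i j)%:E - ext_logprice mu j))%E.

Definition is_minimizer (mu : 'rV[R]_m) : Prop :=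
  forall nu : 'rV[R]_m, (F mu <= F nu)%E.

End objective.

(* The norm that the library puts on 'rV[R]_m is the sup norm, hence this
   separate definition of the closed Euclidean ball. *)
Definition euclidean_cball {R : realType} {m : nat}
    (c : 'rV[R]_m) (r : R) : set 'rV[R]_m :=
  [set x | Num.sqrt (\sum_(j < m) (x 0 j - c 0 j) ^+ 2) <= r].

(* Algorithms are programs of a unit-cost real RAM.  The memory consists of
   two-dimensional arrays of natural numbers (sizes, indices) and of real
   numbers; arrays are named by numbers and their entries are addressed by
   computed indices.  A program is a finite piece of syntax which depends
   neither on the market nor on its dimensions, and the only real constants
   it can contain are natural numbers.  There is no conversion from reals to
   naturals other than through comparisons. *)
Inductive iexpr : Type :=
  | ICst of nat
  | IGet of nat & iexpr & iexpr
  | IAdd of iexpr & iexpr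
  | ISub of iexpr & iexpr.

Inductive rexpr : Type :=
  | RCst of nat
  | RGet of nat & iexpr & iexpr
  | RAdd of rexpr & rexpr
  | RSub of rexpr & rexpr
  | RMul of rexpr & rexpr
  | RDiv of rexpr & rexpr
  | RExp of rexpr
  | RLog of rexpr.

Inductive bexpr : Type :=
  | BILe of iexpr & iexpr
  | BRLe of rexpr & rexpr
  | BNot of bexpr
  | BAnd of bexpr & bexpr.

Inductive cmd : Type :=
  | Skip
  | ISet of nat & iexpr & iexpr & iexpr
  | RSet of nat & iexpr & iexpr & rexpr
  | Seq of cmd & cmd
  | If of bexpr & cmd & cmd
  | While of bexpr & cmd.

(* Every operation, memory access, constant and comparison costs one unit,
   including those on indices. *)
Fixpoint icost (e : iexpr) : nat :=
  match e with
  | ICst _ => 1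
  | IGet _ e1 e2 | IAdd e1 e2 | ISub e1 e2 => (icost e1 + icost e2).+1
  end%N.

Fixpoint rcost (e : rexpr) : nat :=
  match e with
  | RCst _ => 1
  | RGet _ e1 e2 => (icost e1 + icost e2).+1
  | RAdd e1 e2 | RSub e1 e2 | RMul e1 e2 | RDiv e1 e2 =>
      (rcost e1 + rcost e2).+1
  | RExp e1 | RLog e1 => (rcost e1).+1
  end%N.

Fixpoint bcost (b : bexpr) : nat :=
  match b with
  | BILe e1 e2 => (icost e1 + icost e2).+1
  | BRLe e1 e2 => (rcost e1 + rcost e2).+1
  | BNot b1 => (bcost b1).+1
  | BAnd b1 b2 => (bcost b1 + bcost b2).+1
  end%N.

Record state (R : Type) := State {
  imem : nat -> nat -> nat -> nat;
  rmem : nat -> nat -> nat -> R }.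

Definition update {T : Type} (f : nat -> nat -> nat -> T)
    (a i j : nat) (x : T) : nat -> nat -> nat -> T :=
  fun a' i' j' => if [&& a' == a, i' == i & j' == j] then x else f a' i' j'.

Section semantics.
Context {R : realType}.

Fixpoint ieval (s : state R) (e : iexpr) : nat :=
  match e with
  | ICst k => k
  | IGet a e1 e2 => imem s a (ieval s e1) (ieval s e2)
  | IAdd e1 e2 => ieval s e1 + ieval s e2
  | ISub e1 e2 => ieval s e1 - ieval s e2
  end%N.

(* Division and logarithm are made total as in the library: division by 0 and
   the logarithm of a nonpositive number return 0. *)
Fixpoint reval (s : state R) (e : rexpr) : R :=
  match e with
  | RCst k => k%:R
  | RGet a e1 e2 => rmem s a (ieval s e1) (ieval s e2)
  | RAdd e1 e2 => reval s e1 + reval s e2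
  | RSub e1 e2 => reval s e1 - reval s e2
  | RMul e1 e2 => reval s e1 * reval s e2
  | RDiv e1 e2 => reval s e1 / reval s e2
  | RExp e1 => expR (reval s e1)
  | RLog e1 => ln (reval s e1)
  end.

Fixpoint beval (s : state R) (b : bexpr) : bool :=
  match b with
  | BILe e1 e2 => (ieval s e1 <= ieval s e2)%N
  | BRLe e1 e2 => reval s e1 <= reval s e2
  | BNot b1 => ~~ beval s b1
  | BAnd b1 b2 => beval s b1 && beval s b2
  end.

(* exec c s k s': started in state s, the program c halts in state s' after k
   elementary operations. *)
Inductive exec : cmd -> state R -> nat -> state R -> Prop :=
  | exec_skip s : exec Skip s 1 s
  | exec_iset a i j e s :
      exec (ISet a i j e) s (icost i + icost j + icost e).+1%N
        (State (update (imem s) a (ieval s i) (ieval s j) (ieval s e))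
               (rmem s))
  | exec_rset a i j e s :
      exec (RSet a i j e) s (icost i + icost j + rcost e).+1%N
        (State (imem s)
               (update (rmem s) a (ieval s i) (ieval s j) (reval s e)))
  | exec_seq c1 c2 s1 k1 s2 k2 s3 :
      exec c1 s1 k1 s2 -> exec c2 s2 k2 s3 ->
      exec (Seq c1 c2) s1 (k1 + k2)%N s3
  | exec_if b c1 c2 s k s' :
      exec (if beval s b then c1 else c2) s k s' ->
      exec (If b c1 c2) s (bcost b + k).+1%N s'
  | exec_while_false b c s :
      ~~ beval s b -> exec (While b c) s (bcost b).+1%N s
  | exec_while_true b c s1 k1 s2 k2 s3 :
      beval s1 b -> exec c s1 k1 s2 -> exec (While b c) s2 k2 s3 ->
      exec (While b c) s1 (bcost b + k1 + k2).+1%N s3.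

Lemma exec_det c s k1 s1 k2 s2 :
  exec c s k1 s1 -> exec c s k2 s2 -> k1 = k2 /\ s1 = s2.
Proof.
move=> H; elim: H k2 s2 => {c s k1 s1}.
- by move=> s k2 s2 H; inversion H.
- by move=> a i j e s k2 s2 H; inversion H.
- by move=> a i j e s k2 s2 H; inversion H.
- move=> c1 c2 s1 k1 s2 k2 s3 _ IH1 _ IH2 k s H; inversion H; subst.
  have [? ?] := IH1 _ _ ltac:(eassumption); subst.
  by have [? ?] := IH2 _ _ ltac:(eassumption); subst.
- move=> b c1 c2 s k s' _ IH k' s'' H; inversion H; subst.
  by have [? ?] := IH _ _ ltac:(eassumption); subst.
- move=> b c s /negPf nb k s' H; inversion H; subst => //.
  by congruence.
- move=> b c s1 k1 s2 k2 s3 hb _ IH1 _ IH2 k s H; inversion H; subst.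
    by move: hb; rewrite (negPf ltac:(eassumption)).
  have [? ?] := IH1 _ _ ltac:(eassumption); subst.
  by have [? ?] := IH2 _ _ ltac:(eassumption); subst.
Qed.

End semantics.

Section oracle_io.
Context {R : realType} {m n : nat}.

Definition entry {p q : nat} (A : 'M[R]_(p, q)) (i j : nat) : R :=
  match insub i, insub j with
  | Some i', Some j' => A i' j'
  | _, _ => 0
  end.

(* Integer array 0 holds m, n and a flag telling whether alpha = +oo; real
   arrays 0, 1, 2 and 3 hold v, B, mu and r.  The rest of the memory is 0. *)
Definition input_state (M : fisher_market R m n) (mu : 'rV[R]_m) (r : R) :
    state R :=
  State
    (fun a i j => match a, i, j with
       | 0, 0, 0 => m
       | 0, 0, 1 => n
       | 0, 0, 2 => nat_of_bool (alpha M == +oo%E)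
       | _, _, _ => 0
       end%N)
    (fun a i j => match a, i, j with
       | 0, _, _ => entry (utility M) i j
       | 1, _, _ => entry (budget M) i j
       | 2, _, _ => entry mu i j
       | 3, 0, 0 => r
       | _, _, _ => 0
       end).

(* The output is read in row 0 of real array 4. *)
Definition output (s : state R) : 'rV[R]_m := \row_(j < m) rmem s 4 0 j.

(* On the given data, the program p halts after k operations and returns x. *)
Definition returns (p : cmd) (M : fisher_market R m n) (mu : 'rV[R]_m) (r : R)
    (k : nat) (x : 'rV[R]_m) : Prop :=
  exists2 s, exec p (input_state M mu r) k s & output s = x.

End oracle_io.

(* Main.v *)
Require Import Defs.
From mathcomp Require Import all_boot all_order all_algebra.
From mathcomp Require Import all_classical all_reals all_analysis.
From mathcomp Require Import zify ring lra.

(** The objective only sees the bang-per-buck ratios v_ij / exp mu_j: up to the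
logarithm, its i-th maximum is the best ratio of buyer i over the goods and
money, a good of index m and price 1 which has utility 1 in a quasi-linear
market and 0 in a linear one.  At the minimizer, every ratio is either the best
one of its buyer or smaller by a factor at least exp (- d), for some d > 0
(bang_gap).  Moving mu by at most r in every coordinate changes each ratio by a
factor at most exp r, so if 4 r < d the goods whose ratio at mu is within a
factor exp (2 r) of the best are exactly the best goods at the minimizer
(near_best_exact): the oracle recovers the demand graph of the equilibrium from
mu and r, and d can serve as Delta.

The graph and the budgets determine the prices.  Two goods demanded by the same
buyer have prices proportional to the utilities of that buyer, so within a
connected component all prices are known up to one factor.  In the component of
money the factor is fixed by the price 1 of money.  In any other component,
multiplying all its prices by exp t changes F, for small t, by at most
S (exp t - 1) - b t, where S is the total price of the component and b the
total budget of its buyers; minimality at t = 0 forces S = b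
(closed_set_clears), which gives the factor.

The components are computed with labels.  Each good j carries a label and a
ratio such that its price is the ratio times an unknown factor of the label.
Buyer i merges the labels of all goods demanded by i, after rescaling the
ratios of each merged label by v_ij / ratio_j, taken at a demanded good j of
that label; the new common factor is the inverse of the best ratio of i
(merge_ratios).  A buyer costs three loops over the goods, hence O(mn)
operations in total.

Running times are read off the syntax: the program is written with counted
loops whose bounds are at most m + n, and a program with loops nested to depth
k takes O((m + n) ^ k) operations on every input (exec_compile).

Since F is strictly convex the minimizer is unique (is_minimizer_unique), so
that the gap d of one minimizer serves for all. *)

Set Implicit Arguments.
Unset Strict Implicit.
Unset Printing Implicit Defensive.

Import Order.TTheory GRing.Theory Num.Theory.
Import numFieldNormedType.Exports.

Local Open Scope classical_set_scope.
Local Open Scope ring_scope.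

(** * Structured programs and their running times *)

(** The loop PFor x q d b runs b with the entry (0, 0) of the integer array x
equal to 0, ..., N - 1, where N is d plus the entry (0, q) of the input array:
the bounds needed are n, m and m + 1. *)
Inductive prog : Type :=
  | PSkip
  | PISet of nat & iexpr & iexpr & iexpr
  | PRSet of nat & iexpr & iexpr & rexpr
  | PSeq of prog & prog
  | PIf of bexpr & prog & prog
  | PFor of nat & nat & nat & prog.

Definition ivar (x : nat) : iexpr := IGet x (ICst 0) (ICst 0).

Definition trip (q d : nat) : iexpr := IAdd (IGet 0 (ICst 0) (ICst q)) (ICst d).

Fixpoint compile (p : prog) : cmd :=
  match p with
  | PSkip => Skip
  | PISet a i j e => ISet a i j e
  | PRSet a i j e => RSet a i j e
  | PSeq p1 p2 => Seq (compile p1) (compile p2)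
  | PIf b p1 p2 => If b (compile p1) (compile p2)
  | PFor x q d b =>
      Seq (ISet x (ICst 0) (ICst 0) (ICst 0))
        (While (BILe (IAdd (ivar x) (ICst 1)) (trip q d))
           (Seq (compile b)
              (ISet x (ICst 0) (ICst 0) (IAdd (ivar x) (ICst 1)))))
  end.

Fixpoint iwrites (p : prog) (a : nat) : bool :=
  match p with
  | PSkip | PRSet _ _ _ _ => false
  | PISet a' _ _ _ => a == a'
  | PSeq p1 p2 | PIf _ p1 p2 => iwrites p1 a || iwrites p2 a
  | PFor x _ _ b => (a == x) || iwrites b a
  end.

Fixpoint rwrites (p : prog) (a : nat) : bool :=
  match p with
  | PSkip | PISet _ _ _ _ => false
  | PRSet a' _ _ _ => a == a'
  | PSeq p1 p2 | PIf _ p1 p2 => rwrites p1 a || rwrites p2 a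
  | PFor _ _ _ b => rwrites b a
  end.

(** The loop counters are not touched by the loop bodies and the input array,
which holds the loop bounds, is read-only: N is then really the number of
passes.  Since m and n are positive, d <= 1 makes N at most m + n. *)
Fixpoint wf (p : prog) : bool :=
  match p with
  | PSkip | PRSet _ _ _ _ => true
  | PISet a _ _ _ => a != 0
  | PSeq p1 p2 | PIf _ p1 p2 => wf p1 && wf p2
  | PFor x _ d b => [&& x != 0, (d <= 1)%N, ~~ iwrites b x & wf b]
  end.

Fixpoint depth (p : prog) : nat :=
  match p with
  | PSkip | PISet _ _ _ _ | PRSet _ _ _ _ => 0
  | PSeq p1 p2 | PIf _ p1 p2 => maxn (depth p1) (depth p2)
  | PFor _ _ _ b => (depth b).+1
  end.

(** The running time is at most cost_coef p * D ^ depth p, where D bounds the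
numbers of passes.  Around its body, a loop spends 20 operations per pass (test
and increment) and 16 on the initialization and the last test, that is, at most
36 * D in total. *)
Fixpoint cost_coef (p : prog) : nat :=
  match p with
  | PSkip => 1
  | PISet _ i j e => (icost i + icost j + icost e).+1
  | PRSet _ i j e => (icost i + icost j + rcost e).+1
  | PSeq p1 p2 => cost_coef p1 + cost_coef p2
  | PIf b p1 p2 => (bcost b + (cost_coef p1 + cost_coef p2)).+1
  | PFor _ _ _ b => 36 + cost_coef b
  end%N.

Section run.
Context {R : realType}.
Implicit Type s : state R.

Definition seti (x k : nat) s : state R :=
  State (update (imem s) x 0 0 k) (rmem s).

Definition trips s (q d : nat) : nat := (imem s 0 0 q + d)%N.

(** The counter of a loop is set at the start of each pass instead of being
incremented; since the body leaves it alone, the final states are the same. *)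
Fixpoint run (p : prog) s : state R :=
  match p with
  | PSkip => s
  | PISet a i j e =>
      State (update (imem s) a (ieval s i) (ieval s j) (ieval s e)) (rmem s)
  | PRSet a i j e =>
      State (imem s) (update (rmem s) a (ieval s i) (ieval s j) (reval s e))
  | PSeq p1 p2 => run p2 (run p1 s)
  | PIf b p1 p2 => if beval s b then run p1 s else run p2 s
  | PFor x q d b =>
      seti x (trips s q d)
        (iteri (trips s q d) (fun k u => run b (seti x k u)) s)
  end.

Lemma update_neq (T : Type) (f : nat -> nat -> nat -> T) a i j y a' i' j' :
  a' != a -> update f a i j y a' i' j' = f a' i' j'.
Proof. by rewrite /update => /negPf ->. Qed.

Lemma imem_seti x k s a i j :
  a != x -> imem (seti x k s) a i j = imem s a i j.
Proof. exact: update_neq. Qed.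

Lemma iteriP (T : Type) (I : nat -> T -> Prop) (f : nat -> T -> T) N u :
  I 0 u -> (forall k v, (k < N)%N -> I k v -> I k.+1 (f k v)) ->
  I N (iteri N f u).
Proof.
move=> I0 IS; suff H k : (k <= N)%N -> I k (iteri k f u) by exact: H.
elim: k => //= k IH kN; apply: IS => //; exact/IH/ltnW.
Qed.

Lemma imem_run p s a i j :
  ~~ iwrites p a -> imem (run p s) a i j = imem s a i j.
Proof.
elim: p s => //= [a' e1 e2 e3|p1 IH1 p2 IH2|b p1 IH1 p2 IH2|x q d b IH] s.
- by rewrite /update => /negPf ->.
- by rewrite negb_or => /andP[n1 n2]; rewrite IH2// IH1.
- by rewrite negb_or => /andP[n1 n2]; case: ifP => _; rewrite ?IH2// IH1.
- rewrite negb_or => /andP[ax nb]. rewrite update_neq//.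
  apply: (iteriP (I := fun _ u => imem u a i j = imem s a i j)) => // k v _ vE.
  by rewrite IH// imem_seti.
Qed.

Lemma rmem_run p s a i j :
  ~~ rwrites p a -> rmem (run p s) a i j = rmem s a i j.
Proof.
elim: p s => //= [a' e1 e2 e3|p1 IH1 p2 IH2|b p1 IH1 p2 IH2|x q d b IH] s.
- by rewrite /update => /negPf ->.
- by rewrite negb_or => /andP[n1 n2]; rewrite IH2// IH1.
- by rewrite negb_or => /andP[n1 n2]; case: ifP => _; rewrite ?IH2// IH1.
- move=> nb.
  apply: (iteriP (I := fun _ u => rmem u a i j = rmem s a i j)) => // k v _ vE.
  by rewrite IH.
Qed.

Lemma wf_iwrites0 p : wf p -> ~~ iwrites p 0.
Proof.
elim: p => //= [a _ _ _|p1 IH1 p2 IH2|_ p1 IH1 p2 IH2|x _ d b IH].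
- by rewrite eq_sym.
- by case/andP=> /IH1/negPf-> /IH2/negPf->.
- by case/andP=> /IH1/negPf-> /IH2/negPf->.
- by case/and4P=> x0 _ _ /IH/negPf->; rewrite orbF eq_sym.
Qed.

(** The rule of loop invariants, where the arrays that the loop does not write
come for free as unchanged. *)
Lemma run_for (I : nat -> state R -> Prop) x q d b s :
  I 0 s ->
  (forall k u, (k < trips s q d)%N ->
     (forall a i j, ~~ iwrites (PFor x q d b) a -> imem u a i j = imem s a i j) ->
     (forall a i j, ~~ rwrites b a -> rmem u a i j = rmem s a i j) ->
     I k u -> I k.+1 (run b (seti x k u))) ->
  exists2 u, run (PFor x q d b) s = seti x (trips s q d) u & I (trips s q d) u.
Proof.
move=> I0 IS /=; eexists; first by [].
pose fr u := (forall a i j, ~~ iwrites (PFor x q d b) a ->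
                imem u a i j = imem s a i j) /\
             (forall a i j, ~~ rwrites b a -> rmem u a i j = rmem s a i j).
suff [] : I (trips s q d)
    (iteri (trips s q d) (fun k u => run b (seti x k u)) s) /\
  fr (iteri (trips s q d) (fun k u => run b (seti x k u)) s) by [].
apply: (iteriP (I := fun k u => I k u /\ fr u)) => [|k u kN [Iu [f1 f2]]].
  by split.
split; first exact: IS.
split=> a i j wa; last by rewrite rmem_run// f2.
have /= := wa; rewrite negb_or => /andP[ax wb].
by rewrite imem_run// imem_seti// f1.
Qed.

Lemma exec_compile p s D :
  wf p -> (forall q, (imem s 0 0 q < D)%N) ->
  exists2 k, (k <= cost_coef p * D ^ depth p)%N & exec (compile p) s k (run p s).
Proof.
elim: p s => [|a i j e|a i j e|p1 IH1 p2 IH2|b p1 IH1 p2 IH2|x q d b IH] s wfp sD.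
- by exists 1; [rewrite muln1|constructor].
- by eexists; last constructor; rewrite muln1.
- by eexists; last constructor; rewrite muln1.
- have D0 : (0 < D)%N by apply: leq_ltn_trans (sD 0).
  have /andP[w1 w2] : wf p1 && wf p2 := wfp.
  have [k1 k1D e1] := IH1 s w1 sD.
  have [|k2 k2D e2] := IH2 (run p1 s) w2.
    by move=> q; rewrite imem_run//; exact: wf_iwrites0.
  exists (k1 + k2)%N; last exact: exec_seq e1 e2.
  rewrite /= mulnDl leq_add//.
    by apply: leq_trans k1D _; rewrite leq_mul// leq_pexp2l// leq_maxl.
  by apply: leq_trans k2D _; rewrite leq_mul// leq_pexp2l// leq_maxr.
- have D0 : (0 < D)%N by apply: leq_ltn_trans (sD 0).
  have /andP[w1 w2] : wf p1 && wf p2 := wfp.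
  have [k1 k1D e1] := IH1 s w1 sD.
  have [k2 k2D e2] := IH2 s w2 sD.
  have k1D' : (k1 <= cost_coef p1 * D ^ depth (PIf b p1 p2))%N.
    by apply: leq_trans k1D _; rewrite leq_mul// leq_pexp2l// leq_maxl.
  have k2D' : (k2 <= cost_coef p2 * D ^ depth (PIf b p1 p2))%N.
    by apply: leq_trans k2D _; rewrite leq_mul// leq_pexp2l// leq_maxr.
  have : (0 < D ^ depth (PIf b p1 p2))%N by rewrite expn_gt0 D0.
  move: (D ^ _)%N k1D' k2D' => P k1D' k2D' P0.
  exists (bcost b + if beval s b then k1 else k2).+1%N.
    by rewrite /=; case: ifP => _; nia.
  by apply: exec_if; rewrite /=; case: ifP.
- have /and4P[x0 d1 nbx wfb] : wf (PFor x q d b) := wfp.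
  set N := trips s q d; have ND : (N <= D)%N by rewrite /N /trips; have := sD q; lia.
  set K := (cost_coef b * D ^ depth b)%N.
  pose incr := ISet x (ICst 0) (ICst 0) (IAdd (ivar x) (ICst 1)).
  pose c := While (BILe (IAdd (ivar x) (ICst 1)) (trip q d))
              (Seq (compile b) incr).
  (* The state of the compiled loop before its k-th test. *)
  pose t k := seti x k (iteri k (fun k u => run b (seti x k u)) s).
  have tq k q' : imem (t k) 0 0 q' = imem s 0 0 q'.
    rewrite imem_seti; last by rewrite eq_sym.
    apply: (iteriP (I := fun _ u => imem u 0 0 q' = imem s 0 0 q')) => // l v _ vE.
    by rewrite imem_run ?wf_iwrites0// imem_seti// eq_sym.
  have tx k : imem (t k) x 0 0 = k by rewrite /t /seti /= /update !eqxx.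
  have bk k : beval (t k) (BILe (IAdd (ivar x) (ICst 1)) (trip q d)) = (k < N)%N.
    rewrite -[LHS]/(imem (t k) x 0 0 + 1 <= imem (t k) 0 0 q + d)%N.
    by rewrite tq tx addn1.
  suff /(_ N 0%N (addn0 N)) [k0 k0le ek0] : forall l i, (l + i = N)%N ->
      exists2 k0, (k0 <= l * (K + 20) + 12)%N & exec c (t i) k0 (t N).
    exists (4 + k0)%N; last by apply: exec_seq ek0; apply: exec_iset.
    apply: leq_trans (_ : (4 + (D * (K + 20) + 12) <= _)%N).
      by rewrite leq_add2l (leq_trans k0le)// leq_add2r leq_mul2r ND orbT.
    rewrite /= expnS /K.
    have : (0 < D ^ depth b)%N by rewrite expn_gt0 (leq_ltn_trans _ (sD 0)).
    have : (0 < D)%N by apply: leq_ltn_trans (sD 0).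
    by move: (D ^ _)%N (cost_coef b) => P C; nia.
  elim=> [|l IHl] i liN.
    rewrite add0n in liN; rewrite liN; eexists; last first.
      by apply: exec_while_false; rewrite bk ltnn.
    by [].
  have iN : (i < N)%N by lia.
  have [k1 k1D e1] : exists2 k1, (k1 <= K)%N & exec (compile b) (t i) k1 (run b (t i)).
    by apply: IH => // q'; rewrite tq.
  have [|k2 k2D e2] := IHl i.+1; first by lia.
  exists (11 + (k1 + 8) + k2).+1%N; first by nia.
  apply: exec_while_true e2; first by rewrite bk.
  apply: exec_seq e1 _.
  have -> : t i.+1 = State (update (imem (run b (t i))) x 0 0
      (ieval (run b (t i)) (IAdd (ivar x) (ICst 1)))) (rmem (run b (t i))).
    by rewrite /= imem_run// tx addn1.
  exact: exec_iset.
Qed.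

End run.

(** * The objective in terms of bang-per-buck ratios *)

Section entry.
Context {R : realType} {p q : nat}.

Lemma entryE (A : 'M[R]_(p, q)) (i : 'I_p) (j : 'I_q) : entry A i j = A i j.
Proof. by rewrite /entry !valK. Qed.

Lemma entry_out (A : 'M[R]_(p, q)) (i j : nat) : (q <= j)%N -> entry A i j = 0.
Proof. by move=> qj; rewrite /entry [insub j]insubN -?leqNgt//; case: insub. Qed.

End entry.

Lemma euclidean_cball_coord (R : realType) (m : nat) (c x : 'rV[R]_m) r j :
  euclidean_cball c r x -> 0 <= r -> `|entry x 0 j - entry c 0 j| <= r.
Proof.
move=> xr r0; case: (ltnP j m) => [jm|mj]; last first.
  by rewrite !entry_out// subrr normr0.
rewrite -[j]/(val (Ordinal jm)) -[0%N]/(val (ord0 : 'I_1)) !entryE.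
apply: le_trans xr; rewrite -sqrtr_sqr ler_sqrt ?sumr_ge0// => [|i _].
  by rewrite (bigD1 (Ordinal jm))//= lerDl sumr_ge0// => i _; exact: sqr_ge0.
exact: sqr_ge0.
Qed.

Lemma big_option_ord (m : nat) (T : Type) (idx : T) (op : Monoid.com_law idx)
    (f : option 'I_m -> T) (g : nat -> T) :
  f None = g m -> (forall j : 'I_m, f (Some j) = g j) ->
  \big[op/idx]_(o : option 'I_m) f o = \big[op/idx]_(j < m.+1) g j.
Proof.
move=> fN fS.
rewrite (reindex (fun j : 'I_m.+1 => unlift ord_max j))/=.
  apply: eq_bigr => j _; case: unliftP => [j' ->|->]; last by rewrite fN.
  by rewrite fS lift_max.
exists (fun o => if o is Some j then lift ord_max j else ord_max) => [j|[j|]] _.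
- by case: unliftP.
- by rewrite liftK.
- by rewrite unlift_none.
Qed.

Section market.
Context {R : realType} {m n : nat} (M : fisher_market R m n).
Implicit Types x y : 'rV[R]_m.

(** Index m stands for money. *)
Definition value (i j : nat) : R :=
  if (j < m)%N then entry (utility M) i j else (alpha M != +oo%E)%:R.

Definition bang x (i j : nat) : R := value i j / expR (entry x 0 j).

Definition best x (i : nat) : R := \big[Num.max/0]_(j < m.+1) bang x i j.

Lemma bang_ge0 x i j : 0 <= bang x i j.
Proof.
rewrite /bang divr_ge0 ?expR_ge0// /value; case: ifP => // _.
by rewrite /entry; case: insub => [i'|]//; case: insub => [j'|]//; exact: utility_ge0.
Qed.

Lemma bang_le_best x i j : (j <= m)%N -> bang x i j <= best x i.
Proof. by move=> jm; rewrite /best (le_bigmax _ _ (Ordinal (jm : (j < m.+1)%N))). Qed.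

Lemma best_le x i b : 0 <= b ->
  (forall j, (j <= m)%N -> bang x i j <= b) -> best x i <= b.
Proof. by move=> b0 H; apply/bigmax_leP; split => // j _; apply: H; rewrite -ltnS. Qed.

Lemma best_gt0 x i : (i < n)%N -> 0 < best x i.
Proof.
move=> iN; have [j vj] := utility_row_neq0 M (Ordinal iN).
apply: lt_le_trans (bang_le_best x i (ltnW (ltn_ord j))).
rewrite /bang divr_gt0 ?expR_gt0// /value ltn_ord.
by rewrite -[i]/(val (Ordinal iN)) entryE lt_neqAle eq_sym vj utility_ge0.
Qed.

Lemma best_attained x i : (i < n)%N ->
  exists2 j, (j <= m)%N & bang x i j = best x i.
Proof.
move=> iN; have := best_gt0 x iN; rewrite /best.
have [|j _ ->] := @eq_bigmax _ _ _ (0 : R) (@ord0 m) xpredT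
  (fun j : 'I_m.+1 => bang x i j) isT; first by move=> j _; exact: bang_ge0.
by exists j => //; rewrite -ltnS.
Qed.

Lemma bang_change x y i j :
  bang y i j = bang x i j * expR (entry x 0 j - entry y 0 j).
Proof.
rewrite /bang expRD expRN -!mulrA; congr (_ * _).
by rewrite mulrA mulVf ?mul1r// gt_eqF// expR_gt0.
Qed.

Definition Freal x : R :=
  \sum_(j < m) expR (x 0 j) + \sum_(i < n) budget M 0 i * ln (best x i).

(** Both conventions log 0 = -oo and mu_0 = log alpha are absorbed by ratios
equal to 0, which never are the best. *)
Lemma FE x : F M x = (Freal x)%:E.
Proof.
rewrite /F /Freal EFinD; congr (_ + _)%E.
rewrite -sumEFin; apply: eq_bigr => i _; rewrite EFinM; congr (_ * _)%E.
rewrite (@big_option_ord _ _ _ _ _ (fun j => lne (bang x i j)%:E)).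
- rewrite -lne_EFin ?best_gt0// /best.
  suff [] : \big[maxe/-oo%E]_(j < m.+1) lne (bang x i j)%:E =
    lne (\big[Num.max/0]_(j < m.+1) bang x i j)%:E /\
    0 <= \big[Num.max/0]_(j < m.+1) bang x i j by [].
  pose K (e : \bar R) (a : R) := e = lne a%:E /\ 0 <= a.
  apply: (big_ind2 K) => [|e1 a1 e2 a2 [-> a10] [-> a20]|j _].
  + by split; rewrite ?le0_lneNy.
  + split; last by rewrite le_max a10.
    have h (a b : R) : 0 <= a -> a <= b -> (lne a%:E <= lne b%:E)%E.
      move=> a0 ab; rewrite lee_lne// in_itv/= leey andbT lee_fin//.
      exact: le_trans ab.
    case: (leP a1 a2) => a12; first by rewrite (max_idPr (h _ _ a10 a12)).
    by rewrite (max_idPl (h _ _ a20 (ltW a12))).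
  + by split => //; exact: bang_ge0.
- rewrite /ext_utility /ext_logprice /bang /value ltnn entry_out// expR0 divr1.
  case: (alpha_1_or_y M) => ->; first by rewrite lne1 sube0.
  by rewrite eqxx lne1 [RHS]le0_lneNy.
- move=> j; rewrite /ext_utility /ext_logprice /bang /value ltn_ord entryE.
  rewrite -[0%N]/(val (ord0 : 'I_1)) entryE.
  have := utility_ge0 M i j; rewrite le_eqVlt => /orP[/eqP <-|v0].
    by rewrite mul0r le0_lneNy.
  rewrite !lne_EFin// ?divr_gt0 ?expR_gt0//.
  by rewrite ln_div ?posrE ?expR_gt0// expRK EFinB.
Qed.

Lemma is_minimizerE x : is_minimizer M x -> forall y, Freal x <= Freal y.
Proof. by move=> xmin y; have := xmin y; rewrite !FE lee_fin. Qed.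

(** At the midpoint of x and y every ratio is the geometric mean of the ratios
at x and y, so the logarithms of the best ratios are midpoint convex, while the
sum of the exponentials decreases strictly where x and y differ. *)
Lemma is_minimizer_unique x y : is_minimizer M x -> is_minimizer M y -> x = y.
Proof.
move=> /is_minimizerE xmin /is_minimizerE ymin.
pose z : 'rV[R]_m := \row_j ((x 0 j + y 0 j) / 2).
pose g j := (expR (x 0 j / 2) - expR (y 0 j / 2)) ^+ 2.
have zE j : entry z 0 j = (entry x 0 j + entry y 0 j) / 2.
  case: (ltnP j m) => [jm|mj]; last by rewrite !entry_out// addr0 mul0r.
  by rewrite -[j]/(val (Ordinal jm)) -[0%N]/(val (ord0 : 'I_1)) !entryE mxE.
have bz i : (i < n)%N -> 2 * ln (best z i) <= ln (best x i) + ln (best y i).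
  move=> iN; rewrite mulr_natl -lnXn ?best_gt0// -lnM ?posrE ?best_gt0//.
  rewrite ler_ln ?posrE ?exprn_gt0 ?mulr_gt0 ?best_gt0//.
  have [j jm <-] := best_attained z iN.
  have -> : bang z i j ^+ 2 = bang x i j * bang y i j.
    rewrite [bang z i j](bang_change x) [bang y i j](bang_change x) zE.
    rewrite expr2 mulrACA -mulrA -expRD; congr (_ * (_ * expR _)).
    by field.
  by rewrite ler_pM ?bang_ge0// bang_le_best.
have sz : 2 * (\sum_(j < m) expR (z 0 j)) =
    \sum_(j < m) expR (x 0 j) + \sum_(j < m) expR (y 0 j) - \sum_(j < m) g j.
  rewrite -big_split -sumrB mulr_sumr; apply: eq_bigr => j _ /=.
  rewrite mxE /g [(_ + _) / 2]mulrDl expRD.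
  have e2 (a : R) : expR a = expR (a / 2) ^+ 2.
    by rewrite expr2 -expRD; congr expR; field.
  by rewrite (e2 (x 0 j)) (e2 (y 0 j)); ring.
have Fz : 2 * Freal z <= Freal x + Freal y - \sum_(j < m) g j.
  rewrite /Freal mulrDr sz.
  have -> (a b c d e : R) : a + c + (b + d) - e = a + b - e + (c + d) by ring.
  rewrite lerD2l mulr_sumr -big_split ler_sum//= => i _.
  by rewrite mulrCA -mulrDr ler_pM2l ?budget_gt0// bz.
have g0 : \sum_(j < m) g j <= 0.
  by have := xmin z; have := ymin z; move: Fz; lra.
have gj j : g j = 0.
  apply/eqP; rewrite eq_le sqr_ge0 andbT; apply: le_trans g0.
  by rewrite (bigD1 j)//= lerDl sumr_ge0// => k _; exact: sqr_ge0.
apply/rowP => j; have /eqP := gj j.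
rewrite sqrf_eq0 subr_eq0 => /eqP/expR_inj; lra.
Qed.

(** There are finitely many ratios; the value 1/2 in the maximum below only
keeps the gap finite when all ratios are best or zero. *)
Lemma bang_gap x : exists2 d, 0 < d & forall i j, (i < n)%N -> (j <= m)%N ->
  bang x i j = best x i \/ bang x i j <= best x i * expR (- d).
Proof.
pose q (k : 'I_n * 'I_m.+1) : R :=
  if bang x k.1 k.2 == best x k.1 then 2^-1 else bang x k.1 k.2 / best x k.1.
pose g := \big[Num.max/2^-1]_k q k.
have g0 : 0 < g by apply: (@lt_le_trans _ _ 2^-1) => //; exact: bigmax_ge_id.
have g1 : g < 1.
  apply/bigmax_ltP; split=> [|[i j] _]; first by lra.
  rewrite /q /=; case: eqP => [_|/eqP ne]; first by lra.
  rewrite ltr_pdivrMr ?best_gt0// mul1r lt_neqAle ne bang_le_best//.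
  by rewrite -ltnS.
exists (- ln g) => [|i j iN jm]; first by rewrite oppr_gt0 ln_lt0// g0.
rewrite opprK lnK ?posrE//.
case: (eqVneq (bang x i j) (best x i)) => [|ne]; first by left.
right; rewrite mulrC -ler_pdivrMr ?best_gt0//.
have := le_bigmax 2^-1 q (Ordinal iN, Ordinal (jm : (j < m.+1)%N)).
by rewrite /q /= (negPf ne).
Qed.

(** The demand graph as the oracle sees it from the approximate point x. *)
Definition near_best x r (i j : nat) : bool :=
  best x i <= bang x i j * expR (r + r).

(** A best ratio loses at most a factor exp r while the maximum gains at most
exp r, so best goods pass the test with tolerance exp (2 r).  The other goods
would need to gain 4 r on the logarithmic scale, which is less than their gap
d. *)
Lemma near_best_exact x y r d i j : (i < n)%N -> (j <= m)%N ->
  (forall k, `|entry y 0 k - entry x 0 k| <= r) -> r + r + r + r < d ->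
  (bang x i j = best x i \/ bang x i j <= best x i * expR (- d)) ->
  near_best y r i j = (bang x i j == best x i).
Proof.
move=> iN jm xy rd gap.
have close (u w : 'rV[R]_m) k : (forall k, `|entry w 0 k - entry u 0 k| <= r) ->
    bang w i k <= bang u i k * expR r.
  move=> uw; rewrite (bang_change u) ler_wpM2l ?bang_ge0// ler_expR.
  by have := uw k; rewrite ler_distlC => /andP[]; lra.
have yx k : `|entry x 0 k - entry y 0 k| <= r by rewrite distrC.
have closeb (u w : 'rV[R]_m) : (forall k, `|entry w 0 k - entry u 0 k| <= r) ->
    best w i <= best u i * expR r.
  move=> uw; apply: best_le => [|k km].
    by rewrite mulr_ge0 ?expR_ge0// ltW// best_gt0.
  by apply: le_trans (close u w k uw) _; rewrite ler_wpM2r ?expR_ge0// bang_le_best.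
rewrite /near_best; case: eqP => [e|ne].
  apply: le_trans (closeb _ _ xy) _; rewrite -e expRD mulrA ler_wpM2r ?expR_ge0//.
  exact: close.
case: gap => // gap; apply/negbTE; rewrite -ltNge.
apply: (@le_lt_trans _ _ (best x i * expR (- d) * expR r * expR (r + r))).
  rewrite ler_wpM2r ?expR_ge0//; apply: le_trans (close _ _ _ xy) _.
  by rewrite ler_wpM2r ?expR_ge0.
apply: (@lt_le_trans _ _ (best x i * expR (- r))).
  by rewrite -!mulrA -!expRD ltr_pM2l ?best_gt0// ltr_expR; lra.
by rewrite expRN ler_pdivrMr ?expR_gt0// closeb.
Qed.

(** Market clearing for a set A of goods without money which contains all best
goods of the buyers in T and none of the others.  Scaling the prices of A by
exp t with |t| < d keeps best goods best, so the upper bound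
S exp t - b t of the change of F is minimal at t = 0, where its derivative
is S - b. *)
Lemma closed_set_clears x (A T : nat -> bool) : is_minimizer M x -> ~~ A m ->
  (forall i j, (i < n)%N -> (j <= m)%N -> bang x i j = best x i -> A j = T i) ->
  \sum_(j < m) (if A j then expR (x 0 j) else 0) =
  \sum_(i < n) (if T i then budget M 0 i else 0).
Proof.
move=> /is_minimizerE xmin Am AT.
have [d d0 gap] := bang_gap x.
set S := \sum_(j < m) _; set b := \sum_(i < n) _.
pose f (t : R) := S * expR t - b * t.
have fmin t : t \in `](- d), d[ -> f 0 <= f t.
  rewrite in_itv/= => /andP[dt td].
  (* The prices of the goods in A are multiplied by exp t. *)
  pose y : 'rV[R]_m := \row_j (x 0 j + (if A j then t else 0)).
  have yE j : (j <= m)%N -> entry y 0 j = entry x 0 j + (if A j then t else 0).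
    rewrite leq_eqVlt => /predU1P[->|jm].
      by rewrite !entry_out// (negPf Am) addr0.
    by rewrite -[j]/(val (Ordinal jm)) -[0%N]/(val (ord0 : 'I_1)) !entryE mxE.
  (* The best ratio of a buyer in T is divided by exp t; the gap absorbs the
     relative moves of the ratios that are not best. *)
  have by_ i : (i < n)%N -> best y i <= best x i * expR (- (if T i then t else 0)).
    move=> iN; have bi := best_gt0 x iN; apply: best_le => [|j jm].
      by rewrite mulr_ge0 ?expR_ge0// ltW.
    rewrite (bang_change x) yE// opprD addNKr.
    case: (gap i j iN jm) => [e|le]; first by rewrite e (AT i j).
    apply: (@le_trans _ _ (best x i * expR (- d) * expR (- (if A j then t else 0)))).
      by rewrite ler_wpM2r ?expR_ge0.
    rewrite -mulrA -expRD ler_pM2l// ler_expR.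
    by case: (A j); case: (T i); lra.
  have := xmin y; rewrite /Freal.
  have -> : \sum_(j < m) expR (y 0 j) = \sum_(j < m) expR (x 0 j) + S * (expR t - 1).
    rewrite mulr_suml -big_split; apply: eq_bigr => j _ /=; rewrite mxE.
    by case: (A j); rewrite ?addr0 ?expRD; ring.
  have : \sum_(i < n) budget M 0 i * ln (best y i) <=
         \sum_(i < n) budget M 0 i * ln (best x i) - b * t.
    rewrite mulr_suml -sumrB ler_sum// => i _.
    rewrite -[X in _ - X](_ : budget M 0 i * (if T i then t else 0) = _); last first.
      by case: ifP; rewrite ?mulr0 ?mul0r.
    rewrite -mulrBr ler_pM2l ?budget_gt0//.
    apply: (@le_trans _ _ (ln (best x i * expR (- (if T i then t else 0))))).
      by rewrite ler_ln ?posrE ?mulr_gt0 ?best_gt0 ?expR_gt0// by_.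
    by rewrite lnM ?posrE ?best_gt0 ?expR_gt0// expRK.
  by rewrite /f expR0; lra.
have df (t : R) : is_derive t (1 : R) f (S * expR t - b).
  by apply: is_derive_eq; rewrite /GRing.scale /=; ring.
have := @derive1_at_min _ f (- d) d 0.
case/(_ _ _ _ fmin) => [||| _]; first by lra.
- by move=> t _; apply: (@ex_derive _ _ _ _ _ _ _ (df t)).
- by rewrite in_itv /=; lra.
by rewrite (@derive_val _ _ _ _ _ _ _ (df 0)) expR0; lra.
Qed.

End market.

(** * The oracle *)

Local Notation Z := (ICst 0).
Local Notation I := (ivar 1).
Local Notation J := (ivar 2).
Local Notation size_m := (IGet 0 Z Z).
Local Notation linear_flag := (IGet 0 Z (ICst 2)).
Local Notation label e := (IGet 3 Z e).
Local Notation marked := (IGet 4 I (label J)).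
Local Notation chosen := (IGet 5 Z I).
Local Notation v_IJ := (RGet 0 I J).
Local Notation bang_IJ := (RDiv v_IJ (RExp (RGet 2 Z J))).
Local Notation radius := (RGet 3 Z Z).
Local Notation ratio e := (RGet 5 Z e).
Local Notation scale e := (RGet 6 Z e).
Local Notation best_I := (RGet 7 Z Z).
Local Notation supply e := (RGet 8 Z e).
Local Notation money e := (RGet 9 Z e).

Definition add_money_good : prog :=
  PFor 1 1 0 (PIf (BILe linear_flag Z) (PRSet 0 I size_m (RCst 1)) PSkip).

Definition init_labels : prog :=
  PFor 2 0 1 (PSeq (PISet 3 Z J J) (PRSet 5 Z J (RCst 1))).

Definition find_best : prog :=
  PSeq (PRSet 7 Z Z (RCst 0))
    (PFor 2 0 1 (PIf (BRLe best_I bang_IJ) (PRSet 7 Z Z bang_IJ) PSkip)).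

(** The row of marks and the entry of chosen that belong to buyer I have not
been written before, so nothing needs to be reset between buyers.  The ratios
are not updated here because later goods of the same label still need the old
ones. *)
Definition mark_labels : prog :=
  PFor 2 0 1
    (PIf (BRLe best_I (RMul bang_IJ (RExp (RAdd radius radius))))
       (PSeq (PISet 4 I (label J) (ICst 1))
          (PSeq (PRSet 6 Z (label J) (RDiv v_IJ (ratio J)))
             (PISet 5 Z I J)))
       PSkip).

(** Labels are overwritten in place: the label of the chosen good is the common
label, so that reading it in the middle of the loop is safe. *)
Definition merge_labels : prog :=
  PFor 2 0 1
    (PIf (BILe (ICst 1) marked)
       (PSeq (PRSet 5 Z J (RMul (ratio J) (scale (label J))))
          (PISet 3 Z J (label chosen)))
       PSkip).

Definition merge_all : prog :=
  PFor 1 1 0 (PSeq find_best (PSeq mark_labels merge_labels)).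

(** All goods demanded by a buyer have the same label by now, hence the budget
is booked on the label of the chosen one. *)
Definition collect_money : prog :=
  PFor 1 1 0
    (PRSet 9 Z (label chosen) (RAdd (money (label chosen)) (RGet 1 Z I))).

Definition collect_supply : prog :=
  PFor 2 0 0 (PRSet 8 Z (label J) (RAdd (supply (label J)) (ratio J))).

(** The ratio of a good to money is a price as soon as they have the same label.
In a linear market this includes no good, as money is never demanded. *)
Definition write_prices : prog :=
  PFor 2 0 0
    (PIf (BAnd (BILe (label J) (label size_m)) (BILe (label size_m) (label J)))
       (PRSet 4 Z J (RLog (RDiv (ratio J) (ratio size_m))))
       (PRSet 4 Z J (RLog (RMul (ratio J)
          (RDiv (money (label J)) (supply (label J))))))).

Definition equilibrium_oracle : prog :=
  PSeq add_money_good (PSeq init_labels (PSeq merge_all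
    (PSeq collect_money (PSeq collect_supply write_prices)))).

(** * What the loops compute *)

Lemma ltnS_split k j : (j < k.+1)%N = (j == k) || (j < k)%N.
Proof. by rewrite ltnS leq_eqVlt. Qed.

Section loops.
Context {R : realType}.
Implicit Type s : state R.

Lemma bigmax_ord_recr (x : R) k (f : nat -> R) :
  \big[Num.max/x]_(j < k.+1) f j = Num.max (\big[Num.max/x]_(j < k) f j) (f k).
Proof.
apply/eqP; rewrite eq_le ge_max; apply/andP; split.
  apply/bigmax_leP; rewrite le_max bigmax_ge_id; split => // -[j jk] _ /=.
  rewrite le_max; move: jk; rewrite ltnS_split => /predU1P[->|jk].
    by rewrite lexx orbT.
  by rewrite (le_bigmax _ (fun j : 'I_k => f j) (Ordinal jk)).
rewrite (le_bigmax _ (fun j : 'I_k.+1 => f j) ord_max) andbT.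
apply/bigmax_leP; rewrite bigmax_ge_id; split => // j _.
exact: (le_bigmax _ (fun j : 'I_k.+1 => f j) (widen_ord (leqnSn k) j)).
Qed.

Lemma add_money_goodP s i j : (i < imem s 0 0 1)%N ->
  rmem (run add_money_good s) 0 i j =
  if (j == imem s 0 0 0) && (imem s 0 0 2 == 0) then 1 else rmem s 0 i j.
Proof.
move=> iN; have [|k u kN fi fr Iu|u -> /(_ i j)] := @run_for _ (fun k u =>
  forall i j, rmem u 0 i j =
    if [&& (i < k)%N, j == imem s 0 0 0 & imem s 0 0 2 == 0] then 1
    else rmem s 0 i j) 1 1 0
  (PIf (BILe linear_flag Z) (PRSet 0 I size_m (RCst 1)) PSkip) s.
- by [].
- move=> {iN} {}i {}j; rewrite /= /seti /update /= !fi// leqn0 ltnS_split.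
  case f0: (imem s 0 0 2 == 0%N); rewrite /= Iu f0 ?andbT ?andbF//=.
  by case: (i == k); case: (j == _); rewrite ?andbF.
- by rewrite /trips addn0 iN.
Qed.

Lemma init_labelsP s j : (j <= imem s 0 0 0)%N ->
  imem (run init_labels s) 3 0 j = j /\ rmem (run init_labels s) 5 0 j = 1.
Proof.
move=> jm; have [|k u kN fi fr Iu|u -> /(_ j)] := @run_for _ (fun k u =>
  forall j, (j < k)%N -> imem u 3 0 j = j /\ rmem u 5 0 j = 1) 2 0 1
  (PSeq (PISet 3 Z J J) (PRSet 5 Z J (RCst 1))) s.
- by [].
- move=> {jm} {}j; rewrite ltnS_split /= /seti /update /=.
  by case: eqP => [->|_]//= /Iu.
- by apply; rewrite /trips addn1.
Qed.

Lemma find_bestP s :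
  rmem (run find_best s) 7 0 0 = \big[Num.max/0]_(j < (imem s 0 0 0).+1)
    (rmem s 0 (imem s 1 0 0) j / expR (rmem s 2 0 j)).
Proof.
pose s0 := run (PRSet 7 Z Z (RCst 0)) s.
have [|k u kN fi fr Iu|u] := @run_for _ (fun k u =>
  rmem u 7 0 0 = \big[Num.max/0]_(j < k)
    (rmem s 0 (imem s 1 0 0) j / expR (rmem s 2 0 j))) 2 0 1
  (PIf (BRLe best_I bang_IJ) (PRSet 7 Z Z bang_IJ) PSkip) s0.
- by rewrite big_ord0.
- rewrite (bigmax_ord_recr _ _
    (fun j => rmem s 0 (imem s 1 0 0) j / expR (rmem s 2 0 j))) /= -Iu /seti /update /= !fi// !(fr 0%N)// !(fr 2)//.
  by case: leP => //.
- move=> e; have -> : run find_best s = seti _ _ u := e.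
  by rewrite /trips addn1.
Qed.

Lemma mark_labelsP s (i := imem s 1 0 0) (s' := run mark_labels s)
    (E := fun j => rmem s 7 0 0 <=
       rmem s 0 i j / expR (rmem s 2 0 j) * expR (rmem s 3 0 0 + rmem s 3 0 0)) :
  (forall l, imem s 4 i l = 0%N) ->
  [/\ forall l, (0 < imem s' 4 i l)%N ->
        exists j, [/\ (j <= imem s 0 0 0)%N, E j, imem s 3 0 j = l &
          rmem s' 6 0 l = rmem s 0 i j / rmem s 5 0 j],
      forall j, (j <= imem s 0 0 0)%N -> E j -> (0 < imem s' 4 i (imem s 3 0 j))%N,
      forall i' l, i' != i -> imem s' 4 i' l = imem s 4 i' l,
      forall i', i' != i -> imem s' 5 0 i' = imem s 5 0 i' &
      forall j, (j <= imem s 0 0 0)%N -> E j ->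
        (imem s' 5 0 i <= imem s 0 0 0)%N /\ E (imem s' 5 0 i)].
Proof.
move=> mark0.
have [|k u kN fi fr Iu|u] := @run_for _ (fun k u =>
 [/\ forall l, (0 < imem u 4 i l)%N ->
        exists j, [/\ (j < k)%N, E j, imem s 3 0 j = l &
          rmem u 6 0 l = rmem s 0 i j / rmem s 5 0 j],
      forall j, (j < k)%N -> E j -> (0 < imem u 4 i (imem s 3 0 j))%N,
      forall i' l, i' != i -> imem u 4 i' l = imem s 4 i' l,
      forall i', i' != i -> imem u 5 0 i' = imem s 5 0 i' &
      forall j, (j < k)%N -> E j ->
        (imem u 5 0 i < k)%N /\ E (imem u 5 0 i)]) 2 0 1
  (PIf (BRLe best_I (RMul bang_IJ (RExp (RAdd radius radius))))
       (PSeq (PISet 4 I (label J) (ICst 1))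
          (PSeq (PRSet 6 Z (label J) (RDiv v_IJ (ratio J)))
             (PISet 5 Z I J)))
       PSkip) s.
- by split=> // l; rewrite mark0.
- case: Iu => I1 I2 I3 I4 I5.
  rewrite /= /seti /update /= !fi// !fr// -/i -/(E k).
  case Ek: (E k); last first.
    split=> // [l /I1[j [jk Ej Lj sj]]|j|j].
    + by exists j; split => //; exact: ltnW.
    + by rewrite ltnS_split => /predU1P[->|jk]; [rewrite Ek|exact: I2].
    + rewrite ltnS_split => /predU1P[->|jk]; first by rewrite Ek.
      by move=> /(I5 _ jk)[? ?]; split => //; exact: ltnW.
  split=> /=; rewrite /update /= ?eqxx ?fi// ?fr//=.
  + move=> l; case: eqP => [-> _|_ /I1[j [jk Ej Lj sj]]].
      by exists k; split.
    by exists j; split => //; exact: ltnW.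
  + move=> j; rewrite ltnS_split => /predU1P[->|jk]; first by rewrite eqxx.
    by move=> Ej; case: eqP => // _; exact: I2.
  + by move=> i' l /negPf ne; rewrite ne /= I3// ne.
  + by move=> i' /negPf ne; rewrite ne I4// ne.
- rewrite /trips addn1 => e [I1 I2 I3 I4 I5]; have {}e : s' = seti _ _ u := e.
  by rewrite e; split.
Qed.

Lemma merge_labelsP s (i := imem s 1 0 0) (s' := run merge_labels s) j :
  (j <= imem s 0 0 0)%N ->
  imem s' 3 0 j = (if (0 < imem s 4 i (imem s 3 0 j))%N
    then imem s 3 0 (imem s 5 0 i) else imem s 3 0 j) /\
  rmem s' 5 0 j = (if (0 < imem s 4 i (imem s 3 0 j))%N
    then rmem s 5 0 j * rmem s 6 0 (imem s 3 0 j) else rmem s 5 0 j).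
Proof.
move=> jm.
have [|k u kN fi fr Iu|u e /(_ j)] := @run_for _ (fun k u => forall j,
  imem u 3 0 j = (if (j < k)%N && (0 < imem s 4 i (imem s 3 0 j))%N
    then imem s 3 0 (imem s 5 0 i) else imem s 3 0 j) /\
  rmem u 5 0 j = (if (j < k)%N && (0 < imem s 4 i (imem s 3 0 j))%N
    then rmem s 5 0 j * rmem s 6 0 (imem s 3 0 j) else rmem s 5 0 j)) 2 0 1
  (PIf (BILe (ICst 1) marked)
       (PSeq (PRSet 5 Z J (RMul (ratio J) (scale (label J))))
          (PISet 3 Z J (label chosen)))
       PSkip) s.
- by [].
- have [Lk ck] := Iu k; rewrite ltnn /= in Lk ck.
  have Lref : imem u 3 0 (imem s 5 0 i) = imem s 3 0 (imem s 5 0 i).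
    by have [-> _] := Iu (imem s 5 0 i); case: ifP.
  move=> {jm} {}j; have [Lj cj] := Iu j.
  rewrite /= /seti /update /= !(fi 1%N)// !(fi 4%N)// !(fi 5%N)// -/i Lk ltnS_split.
  case mk: (0 < imem s 4 i (imem s 3 0 k))%N => /=; last first.
    rewrite Lj cj; case: eqP => [->|_]//=.
    by rewrite ltnn mk.
  rewrite Lref (fr 6%N)// ck.
  by case: eqP => [->|_]/=; rewrite ?mk.
- have {}e : s' = seti _ _ u := e.
  by rewrite e /trips addn1 ltnS jm.
Qed.

Lemma collect_moneyP s l : (forall l, rmem s 9 0 l = 0) ->
  rmem (run collect_money s) 9 0 l = \sum_(i < imem s 0 0 1)
    (if imem s 3 0 (imem s 5 0 i) == l then rmem s 1 0 i else 0).
Proof.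
move=> s0; have [|k u kN fi fr Iu|u -> /(_ l)] := @run_for _ (fun k u =>
  forall l, rmem u 9 0 l = \sum_(i < k)
    (if imem s 3 0 (imem s 5 0 i) == l then rmem s 1 0 i else 0)) 1 1 0
  (PRSet 9 Z (label chosen) (RAdd (money (label chosen)) (RGet 1 Z I))) s.
- by move=> l'; rewrite big_ord0.
- move=> {}l; rewrite big_ord_recr /= /seti /update /= !fi// (fr 1%N)// -Iu eq_sym.
  by case: eqP => [->|_]//; rewrite addr0.
- by rewrite /trips addn0.
Qed.

Lemma collect_supplyP s l : (forall l, rmem s 8 0 l = 0) ->
  rmem (run collect_supply s) 8 0 l = \sum_(j < imem s 0 0 0)
    (if imem s 3 0 j == l then rmem s 5 0 j else 0).
Proof.
move=> s0; have [|k u kN fi fr Iu|u -> /(_ l)] := @run_for _ (fun k u =>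
  forall l, rmem u 8 0 l = \sum_(j < k)
    (if imem s 3 0 j == l then rmem s 5 0 j else 0)) 2 0 0
  (PRSet 8 Z (label J) (RAdd (supply (label J)) (ratio J))) s.
- by move=> l'; rewrite big_ord0.
- move=> {}l; rewrite big_ord_recr /= /seti /update /= !fi// (fr 5%N)// -Iu eq_sym.
  by case: eqP => [->|_]//; rewrite addr0.
- by rewrite /trips addn0.
Qed.

Lemma write_pricesP s (m := imem s 0 0 0) j : (j < m)%N ->
  rmem (run write_prices s) 4 0 j =
  if imem s 3 0 j == imem s 3 0 m then ln (rmem s 5 0 j / rmem s 5 0 m)
  else ln (rmem s 5 0 j *
           (rmem s 9 0 (imem s 3 0 j) / rmem s 8 0 (imem s 3 0 j))).
Proof.
move=> jm; have [|k u kN fi fr Iu|u -> /(_ j)] := @run_for _ (fun k u =>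
  forall j, (j < k)%N -> rmem u 4 0 j =
    if imem s 3 0 j == imem s 3 0 m then ln (rmem s 5 0 j / rmem s 5 0 m)
    else ln (rmem s 5 0 j *
             (rmem s 9 0 (imem s 3 0 j) / rmem s 8 0 (imem s 3 0 j)))) 2 0 0
  (PIf (BAnd (BILe (label J) (label size_m)) (BILe (label size_m) (label J)))
       (PRSet 4 Z J (RLog (RDiv (ratio J) (ratio size_m))))
       (PRSet 4 Z J (RLog (RMul (ratio J)
          (RDiv (money (label J)) (supply (label J))))))) s.
- by [].
- move=> {jm} {}j; rewrite ltnS_split /= /seti /update /= !fi// -eqn_leq -/m.
  case Lk: (imem s 3 0 k == imem s 3 0 m); rewrite /= /update /= ?fi//;
    case: (eqVneq j k) => [->|_] /= jk; rewrite ?Lk ?Iu//.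
    by rewrite !(fr 5%N)// fi.
  by rewrite (fr 5%N)// (fr 8%N)// (fr 9%N)// fi.
- by apply; rewrite /trips addn0.
Qed.

End loops.

(** * Correctness of the oracle *)

(** For one buyer with best ratio lam: a marked label l with good j has factor
p_j / c_j = lam^-1 * (v_j / c_j), so after multiplying the ratios of l by
v_j / c_j its factor is lam^-1, the same for all marked labels.  Goods of an
unmarked label are not affected, since the label of ref is marked. *)
Lemma merge_ratios (R : realType) (m ref : nat) (p c c' v sc t : nat -> R)
    (L L' : nat -> nat) (mk E : nat -> bool) (lam : R) :
  (forall j, (j <= m)%N -> 0 < p j) ->
  (forall j, (j <= m)%N -> p j = c j * t (L j)) -> 0 < lam ->
  (forall j, (j <= m)%N -> E j -> v j = lam * p j) ->
  (forall l, mk l -> exists j, [/\ (j <= m)%N, E j, L j = l & sc l = v j / c j]) ->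
  mk (L ref) ->
  (forall j, (j <= m)%N -> L' j = if mk (L j) then L ref else L j) ->
  (forall j, (j <= m)%N -> c' j = if mk (L j) then c j * sc (L j) else c j) ->
  exists t', forall j, (j <= m)%N -> p j = c' j * t' (L' j).
Proof.
move=> p0 pE lam0 vE mkE mkref L'E c'E.
exists (fun l => if l == L ref then lam^-1 else t l) => j jm.
rewrite L'E// c'E//; case: ifP => mkj; last first.
  by case: eqP => [e|_]; [rewrite e mkref in mkj|exact: pE].
have [j' [j'm Ej' Lj' ->]] := mkE _ mkj.
have c0 : c j' != 0.
  by apply/eqP => c0; have := p0 _ j'm; rewrite pE// c0 mul0r ltxx.
rewrite eqxx vE// [p j']pE// Lj' pE//.
by field; rewrite c0 gt_eqF.
Qed.

Section correctness.
Context {R : realType} {m n : nat} (M : fisher_market R m n).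
Variables (x mu : 'rV[R]_m) (r : R).
Hypothesis x_min : is_minimizer M x.
Hypothesis near_x : forall i j, (i < n)%N -> (j <= m)%N ->
  near_best M mu r i j = (bang M x i j == best M x i).

Let price (j : nat) : R := expR (entry x 0 j).

Definition holds_input (s : state R) : Prop :=
  [/\ imem s 0 0 0 = m, imem s 0 0 1 = n,
      forall i j, (i < n)%N -> (j <= m)%N -> rmem s 0 i j = value M i j,
      forall j, rmem s 2 0 j = entry mu 0 j & rmem s 3 0 0 = r].

(** The invariant after the first k buyers: the rows of marks of the other buyers
are blank, the ratios are correct up to one factor for each label, and the set
of goods with a given label is closed under the demands of the first k
buyers. *)
Definition merged (k : nat) (s : state R) : Prop :=
  [/\ forall i l, (k <= i)%N -> imem s 4 i l = 0%N,
      exists t, forall j, (j <= m)%N -> price j = rmem s 5 0 j * t (imem s 3 0 j) &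
      forall i, (i < k)%N -> [/\ (imem s 5 0 i <= m)%N,
        near_best M mu r i (imem s 5 0 i) &
        forall j, (j <= m)%N -> near_best M mu r i j ->
          imem s 3 0 j = imem s 3 0 (imem s 5 0 i)]].

Lemma holds_input_run p s : ~~ iwrites p 0 ->
  ~~ rwrites p 0 -> ~~ rwrites p 2 -> ~~ rwrites p 3 ->
  holds_input s -> holds_input (run p s).
Proof.
move=> i0 r0 r2 r3 [sm sn sv smu sr].
split=> [||i j ? ?|j|]; rewrite ?imem_run ?rmem_run//; exact: sv.
Qed.

Lemma merge_step i s : (i < n)%N -> holds_input s -> imem s 1 0 0 = i ->
  merged i s -> merged i.+1 (run (PSeq find_best (PSeq mark_labels merge_labels)) s).
Proof.
move=> iN Hs s1 [fresh [t tE] edges].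
pose u := run find_best s; pose w := run mark_labels u.
rewrite -[run _ s]/(run merge_labels w).
have Hu : holds_input u by apply: holds_input_run.
have Hw : holds_input w by apply: holds_input_run.
have [sm sn sv smu sr] := Hs; have [um un uv umu ur] := Hu.
have [wm wn wv wmu wr] := Hw.
have u1 : imem u 1 0 0 = i by rewrite imem_run.
have w1 : imem w 1 0 0 = i by rewrite imem_run.
have ubest : rmem u 7 0 0 = best M mu i.
  rewrite find_bestP sm s1; apply: eq_bigr => j _.
  by rewrite sv ?smu// -ltnS.
have uE j : (j <= m)%N -> (rmem u 7 0 0 <= rmem u 0 i j / expR (rmem u 2 0 j) *
    expR (rmem u 3 0 0 + rmem u 3 0 0)) = near_best M mu r i j.
  by move=> jm; rewrite ubest uv// umu ur.
have uL j : imem u 3 0 j = imem s 3 0 j by rewrite imem_run.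
have uc j : rmem u 5 0 j = rmem s 5 0 j by rewrite rmem_run.
have wL j : imem w 3 0 j = imem s 3 0 j by rewrite imem_run// uL.
have wc j : rmem w 5 0 j = rmem s 5 0 j by rewrite rmem_run// uc.
have [|mk_ex mk_all mk_old ref_old ref_new] := @mark_labelsP _ u.
  by move=> l; rewrite u1 imem_run// fresh.
rewrite -/w u1 um in mk_ex mk_all mk_old ref_old ref_new.
have [j0 j0m /eqP] := best_attained M x iN; rewrite -near_x// => Ej0.
have [|] := ref_new j0 j0m; first by rewrite uE.
set ref := imem w 5 0 i => refm; rewrite uE// => Eref.
pose mk l := (0 < imem w 4 i l)%N.
pose q := run merge_labels w.
have qL j : (j <= m)%N ->
    imem q 3 0 j = if mk (imem s 3 0 j) then imem s 3 0 ref else imem s 3 0 j.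
  by move=> jm; have [|-> _] := @merge_labelsP _ w j; rewrite ?wm// w1 !wL.
have qc j : (j <= m)%N -> rmem q 5 0 j = if mk (imem s 3 0 j)
    then rmem s 5 0 j * rmem w 6 0 (imem s 3 0 j) else rmem s 5 0 j.
  by move=> jm; have [|_ ->] := @merge_labelsP _ w j; rewrite ?wm// w1 wL wc.
have mkE j : (j <= m)%N -> near_best M mu r i j -> mk (imem s 3 0 j).
  by move=> jm Ej; rewrite -uL; apply: mk_all; rewrite ?uE.
have q4 i' l : imem q 4 i' l = imem w 4 i' l by rewrite imem_run.
have q5 i' : imem q 5 0 i' = imem w 5 0 i' by rewrite imem_run.
split.
- move=> i' l ii'; rewrite q4 mk_old; last by rewrite gt_eqF.
  by rewrite imem_run// fresh// ltnW.
- apply: (@merge_ratios _ m ref _ (fun j => rmem s 5 0 j) _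
    (value M i) (rmem w 6 0) t (fun j => imem s 3 0 j) _ mk
    (near_best M mu r i) (best M x i)) => //.
  + by move=> j _; exact: expR_gt0.
  + exact: best_gt0.
  + move=> j jm; rewrite near_x// => /eqP <-.
    by rewrite /bang mulfVK// gt_eqF// expR_gt0.
  + move=> l /mk_ex[j [jm Ej Lj sj]]; exists j; split => //.
    * by rewrite -uE.
    * by rewrite -uL.
    * by rewrite sj uv// uc.
  + exact: mkE.
- move=> i'; rewrite ltnS_split q5 => /predU1P[->|i'i].
    split=> // j jm Ej; rewrite !qL// !mkE//.
  have [refm' Eref' close] := edges _ i'i.
  have -> : imem w 5 0 i' = imem s 5 0 i'.
    by rewrite ref_old ?imem_run// lt_eqF.
  split=> // j jm Ej; rewrite !qL//.
  by rewrite (close j).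
Qed.

Lemma merge_allP s : holds_input s ->
  (forall i l, imem s 4 i l = 0%N) ->
  (forall j, (j <= m)%N -> imem s 3 0 j = j /\ rmem s 5 0 j = 1) ->
  merged n (run merge_all s).
Proof.
move=> Hs s4 sL; have [sm sn sv smu sr] := Hs.
have [|k u kN fi fr Iu|u -> ] := @run_for _ merged 1 1 0
  (PSeq find_best (PSeq mark_labels merge_labels)) s.
- split=> //; exists price => j jm.
  by have [-> ->] := sL _ jm; rewrite mul1r.
- have kn : (k < n)%N by move: kN; rewrite /trips addn0 sn.
  apply: merge_step => //.
  split=> [||i j ? ?|j|]; rewrite ?fr//=; [by rewrite /seti/= update_neq// fi|
    by rewrite /seti/= update_neq// fi|exact: sv].
- by rewrite /trips addn0 sn.
Qed.

(** The label of money has a known factor because money has price 1; the factor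
of any other label is money over supply by market clearing. *)
Lemma recovered_price s (j : 'I_m) (l := imem s 3 0 j) : merged n s ->
  (if l == imem s 3 0 m then ln (rmem s 5 0 j / rmem s 5 0 m)
   else ln (rmem s 5 0 j *
     ((\sum_(i < n) (if imem s 3 0 (imem s 5 0 i) == l then budget M 0 i else 0)) /
      (\sum_(k < m) (if imem s 3 0 k == l then rmem s 5 0 k else 0))))) = x 0 j.
Proof.
move=> [_ [t tE] edges].
have jm : (j <= m)%N by apply: ltnW.
have priceE (k : 'I_m) : price k = expR (x 0 k).
  by rewrite /price -[0%N]/(val (ord0 : 'I_1)) entryE.
have price0 k : price k != 0 by rewrite gt_eqF// expR_gt0.
have tnz k : (k <= m)%N -> t (imem s 3 0 k) != 0.
  by move=> km; have := price0 k; rewrite tE// mulf_eq0 negb_or => /andP[].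
case: eqP => [e|/eqP ne].
  have cm : rmem s 5 0 m = (t l)^-1.
    have := tE m (leqnn m); rewrite /price entry_out// expR0 -e => t1.
    by apply: (mulIf (tnz j jm)); rewrite -/l mulVf ?tnz.
  by rewrite cm invrK -tE// priceE expRK.
pose A k := imem s 3 0 k == l; pose T i := imem s 3 0 (imem s 5 0 i) == l.
have Am : ~~ A m by rewrite /A eq_sym.
have AT i k : (i < n)%N -> (k <= m)%N -> bang M x i k = best M x i -> A k = T i.
  move=> iN km /eqP; rewrite -near_x// => Ek.
  by have [_ _ /(_ _ km Ek)] := edges _ iN; rewrite /A /T => ->.
have := closed_set_clears x_min Am AT.
under eq_bigr => k _.
  rewrite -priceE tE; last exact: ltnW.
  rewrite (_ : (if _ then _ else _) = (if A k then rmem s 5 0 k else 0) * t l).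
    over.
  by rewrite /A; case: eqP => [->|_]//; rewrite mul0r.
rewrite -mulr_suml /A /T => <-.
set S := \sum_(k < m) _.
have S0 : S != 0.
  have : 0 < S * t l.
    rewrite mulr_suml (bigD1 j)//= eqxx -tE// ltr_pwDl ?expR_gt0//.
    apply: sumr_ge0 => k _; case: eqP => [e|_]; last by rewrite mul0r.
    by rewrite -e -tE ?expR_ge0// ltnW.
  by apply: contraTneq => ->; rewrite mul0r ltxx.
by rewrite mulrAC mulfV// mul1r -tE// priceE expRK.
Qed.

Lemma equilibrium_oracleP :
  output (run equilibrium_oracle (input_state M mu r)) = x :> 'rV[R]_m.
Proof.
set s0 := input_state M mu r.
pose s1 := run add_money_good s0; pose s2 := run init_labels s1.
pose s3 := run merge_all s2; pose s4 := run collect_money s3.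
pose s5 := run collect_supply s4.
have H1 : holds_input s1.
  split=> [||i j iN jm|j|]; rewrite ?imem_run//; [|by rewrite rmem_run..].
  rewrite add_money_goodP// /value /=.
  move: jm; rewrite leq_eqVlt => /predU1P[->|jm].
    rewrite eqxx ltnn eqb0 /=; case: eqP => //= _.
    by rewrite entry_out.
  by rewrite ltn_eqF// jm.
have H2 : holds_input s2 by apply: holds_input_run.
have H3 : holds_input s3 by apply: holds_input_run.
have H4 : holds_input s4 by apply: holds_input_run.
have H5 : holds_input s5 by apply: holds_input_run.
have M3 : merged n s3.
  apply: merge_allP => // [i l|j jm]; first by rewrite !imem_run.
  by apply: init_labelsP; have [->] := H1.
have s3B i : rmem s3 1 0 i = entry (budget M) 0 i by rewrite !rmem_run.
apply/rowP => j; rewrite mxE -[run _ _]/(run write_prices s5).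
have [m3 n3 _ _ _] := H3; have [m4 n4 _ _ _] := H4; have [m5 n5 _ _ _] := H5.
rewrite write_pricesP m5// -(recovered_price j M3).
have L5 k : imem s5 3 0 k = imem s3 3 0 k by rewrite imem_run// imem_run.
have c5 k : rmem s5 5 0 k = rmem s3 5 0 k by rewrite rmem_run// rmem_run.
rewrite !L5 !c5; case: ifP => // _; congr (ln (_ * (_ / _))).
  rewrite rmem_run// collect_moneyP => [|l]; last by rewrite !rmem_run.
  rewrite n3; apply: eq_bigr => i _; rewrite s3B.
  by rewrite -(entryE (budget M) ord0 i).
rewrite collect_supplyP => [|l]; last by rewrite !rmem_run.
by rewrite m4; apply: eq_bigr => k _; rewrite imem_run// rmem_run.
Qed.

End correctness.

Theorem theorem5p1 (R : realType) :
  exists (p : cmd) (C : nat),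
    forall (m n : nat) (M : fisher_market R m n), (1 <= m)%N -> (1 <= n)%N ->
    exists oracle : 'rV[R]_m -> R -> 'rV[R]_m,
      (forall (mu : 'rV[R]_m) (r : R),
         exists2 k : nat, (k <= C * (m + n) ^ 2)%N &
           returns p M mu r k (oracle mu r)) /\
      (exists2 Delta : R, 0 < Delta &
         forall mu_star : 'rV[R]_m, is_minimizer M mu_star ->
           forall (mu : 'rV[R]_m) (r : R),
             euclidean_cball mu_star r mu -> 0 < r < Delta / 4 ->
             oracle mu r = mu_star).
Proof.
exists (compile equilibrium_oracle), (cost_coef equilibrium_oracle).
move=> m n M m1 n1.
exists (fun mu r => output (run equilibrium_oracle (input_state M mu r))).
split=> [mu r|].
  have [//||k kle ek] :=
    @exec_compile R equilibrium_oracle (input_state M mu r) (m + n).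
    by case=> [|[|[|q]]] /=; [lia|lia|case: (_ == _) => /=; lia|lia].
  exists k => //.
  by exists (run equilibrium_oracle (input_state M mu r)).
have [[x x_min]|no_min] := pselect (exists x, is_minimizer M x); last first.
  by exists 1 => // x x_min; case: no_min; exists x.
have [d d0 gap] := bang_gap M x.
exists d => // y y_min mu r mur /andP[r0 rd].
rewrite -(is_minimizer_unique x_min y_min) in mur *.
apply: equilibrium_oracleP => // i j iN jm.
apply: (@near_best_exact _ _ _ M _ _ _ d) => //.
- by move=> k; apply: euclidean_cball_coord => //; exact: ltW.
- by lra.
- exact: gap.
Qed.
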